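(* Let $\epsilon = \epsilon(n)$ be such that $|\epsilon|^3 n \rightarrow \infty$ and $\epsilon = o(1)$, and let $p=\frac{1 + \epsilon}{n}$. (i) If $\epsilon < 0$, then with probability $1 - O\left(\left(|\epsilon|^3 n\right)^{-1}\right)$, $G(n,n,p)$ contains no complex components. (ii) If $\epsilon > 0$, then with probability $1 - O\left(\left(\epsilon^3 n\right)^{-1}\right)$, $G(n,n,p)$ contains no complex components of order at most $n^{\frac{2}{3}}$.
   Context: $G(n,n,p)$ is the binomial random bipartite graph with two partition classes, each of size $n$, in which each edge between the classes is included independently with probability $p$. A complex component is a component containing more than one cycle; the order of a component is its number of vertices. All asymptotics are as $n\to\infty$. *)

(* Defs.v *)
From HB Require Import structures.
From mathcomp Require Import all_boot all_order all_algebra.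
From mathcomp Require Import all_classical all_reals all_analysis.

Set Implicit Arguments.
Unset Strict Implicit.
Unset Printing Implicit Defensive.

Import Order.TTheory GRing.Theory Num.Theory.
Import numFieldNormedType.Exports.

Local Open Scope ring_scope.

Definition component (V : finType) (e : rel V) (C : {set V}) : Prop :=
  exists x : V, C = [set y | connect e x y]%SET.

(* The size bound excludes the degenerate closed walk x, y of length 2 given
   by a single edge of a symmetric relation. *)
Definition graph_cycle (V : finType) (e : rel V) (c : seq V) : bool :=
  ucycleb e c && (2 < size c)%N.

(* Cycles are counted as subgraphs: two vertex sequences differing only by a
   rotation or a reversal have the same edge set. *)
Definition cycle_edges (V : finType) (c : seq V) : {set {set V}} :=
  [set [set x; next c x] | x in c]%SET.

Definition complex_component (V : finType) (e : rel V) (C : {set V}) : Prop :=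
  component e C /\
  exists c1 c2 : seq V,
    [/\ graph_cycle e c1, graph_cycle e c2,
        {subset c1 <= C}, {subset c2 <= C} &
        cycle_edges c1 <> cycle_edges c2].

(* (i, j) \in E encodes the edge joining vertex i of the left class to
   vertex j of the right class. *)
Definition bip_adj (n : nat) (E : {set 'I_n * 'I_n}) : rel ('I_n + 'I_n) :=
  fun u v =>
    match u, v with
    | inl i, inr j | inr j, inl i => (i, j) \in E
    | _, _ => false
    end.

Definition bip_weight (R : realType) (n : nat) (p : R)
    (E : {set 'I_n * 'I_n}) : R :=
  \prod_(ij : 'I_n * 'I_n) (if ij \in E then p else 1 - p).

(* Probability that G(n, n, p) satisfies A; this is a probability only when
   0 <= p <= 1. *)
Definition bip_prob (R : realType) (n : nat) (p : R)
    (A : rel ('I_n + 'I_n) -> Prop) : R :=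
  \sum_(E : {set 'I_n * 'I_n} | `[< A (bip_adj E) >]) bip_weight p E.

(* Main.v *)
(** Call a component an excess component if it has more edges than vertices; a
    complex component is one, since an edge can be removed from each of two
    different cycles without disconnecting it.

    An excess component contains a path together with two further edges joining
    the ends of the path to vertices of the path.  There are at most
    [2 n^m m^2] such configurations on [m] vertices, each with [m + 1] edges, so
    for [p = (1 - d) / n] the expected number of excess components is at most
    [sum_m 2 m^2 (1 - d)^(m+1) / n = O(1 / (d^3 n))].  This settles [eps < 0].

    For [eps > 0] we compare [p = (1 + eps) / n] with [p' = (1 - eps/2) / n].  If
    [C] has [k] vertices and is an excess component, then no edge leaves [C], and
    [k + 1] of the edges inside [C] (a spanning tree and two more) witness this.
    Keeping every edge with probability [p' / p] therefore shows that
    [P_p(C) <= ((1 - p) / (1 - p'))^c (p / p')^(k+1) P_p'(C)], where [c] is the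
    number of pairs leaving [C].  As [c >= n k - k^2 / 2], the factor is about
    [exp (- 3/8 eps^2 k + 3/4 eps k^2 / n)], which is bounded for
    [k <= n^(2/3)] because [n^(2/3)] is much smaller than [eps n]. *)

Require Import Defs.
From HB Require Import structures.
From mathcomp Require Import all_boot all_order all_algebra.
From mathcomp Require Import all_classical all_reals all_analysis.
From mathcomp Require Import zify ring lra.

Set Implicit Arguments.
Unset Strict Implicit.
Unset Printing Implicit Defensive.

Import Order.TTheory GRing.Theory Num.Theory.
Import numFieldNormedType.Exports.

(** * Undirected edges and the edge sequences of walks *)

Definition edge_of n (u v : 'I_n + 'I_n) : option ('I_n * 'I_n) :=
  match u, v with
  | inl i, inr j | inr j, inl i => Some (i, j)
  | _, _ => None
  end.

(** Each consecutive pair keeps an entry, possibly [None], so every vertex sequence has an edge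
    sequence of known length; the [None] entries are excluded when configurations are counted. *)
Definition walk_edges n (s : seq ('I_n + 'I_n)) : seq (option ('I_n * 'I_n)) :=
  if s is x :: p then pairmap (@edge_of n) x p else [::].

Definition induced_edges n (E : {set 'I_n * 'I_n}) (C : {set 'I_n + 'I_n}) :
    {set 'I_n * 'I_n} :=
  [set ij in E | (inl ij.1 \in C) && (inr ij.2 \in C)]%SET.

Lemma bip_adjP n (E : {set 'I_n * 'I_n}) u v :
  reflect (exists2 ij, edge_of u v = Some ij & ij \in E) (bip_adj E u v).
Proof.
case: u v => [i|i] [j|j] /=; try by constructor; case.
- by apply: (iffP idP) => [h|[_ [<-]]//]; exists (i, j).
- by apply: (iffP idP) => [h|[_ [<-]]//]; exists (j, i).
Qed.

Lemma edge_ofC n (u v : 'I_n + 'I_n) : edge_of u v = edge_of v u.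
Proof. by case: u v => [i|i] [j|j]. Qed.

Lemma bip_adjC n (E : {set 'I_n * 'I_n}) : symmetric (bip_adj E).
Proof. by case=> [i|i] [j|j]. Qed.

Lemma bip_adj_irrefl n (E : {set 'I_n * 'I_n}) u : bip_adj E u u = false.
Proof. by case: u. Qed.

Lemma edge_of_inj n (u v x y : 'I_n + 'I_n) :
  edge_of u v -> edge_of u v = edge_of x y ->
  (u = x /\ v = y) \/ (u = y /\ v = x).
Proof.
by case: u v x y => [i|i] [j|j] [k|k] [l|l] //= _ [-> ->]; [left|right|right|left].
Qed.

Lemma walk_edges_cons n (x y : 'I_n + 'I_n) s :
  walk_edges (x :: y :: s) = edge_of x y :: walk_edges (y :: s).
Proof. by []. Qed.

Lemma walk_edges_rcons n (x y : 'I_n + 'I_n) s :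
  walk_edges (rcons (x :: s) y) =
  rcons (walk_edges (x :: s)) (edge_of (last x s) y).
Proof. by elim: s x => //= z s IHs x; rewrite -IHs. Qed.

Lemma walk_edges_rev n (s : seq ('I_n + 'I_n)) :
  walk_edges (rev s) = rev (walk_edges s).
Proof.
elim: s => // x [|y s] IHs //; rewrite walk_edges_cons [RHS]rev_cons -IHs.
rewrite rev_cons; case E: (rev (y :: s)) => [|z t].
  by move/(congr1 size): E; rewrite size_rev.
rewrite walk_edges_rcons edge_ofC; congr (rcons _ (edge_of _ _)).
have -> : last z t = last y (z :: t) by [].
by rewrite -E rev_cons last_rcons.
Qed.

Lemma size_walk_edges n (s : seq ('I_n + 'I_n)) :
  size (walk_edges s) = (size s).-1.
Proof. by case: s => //= x s; rewrite size_pairmap. Qed.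

Lemma mem_walk_edges n (s : seq ('I_n + 'I_n)) u v :
  edge_of u v -> edge_of u v \in walk_edges s -> (u \in s) && (v \in s).
Proof.
move=> uv; elim: s => // x [|y s] IHs //; rewrite walk_edges_cons in_cons.
case/orP=> [/eqP/(edge_of_inj uv)[] [-> ->]|/IHs /andP[us vs]].
- by rewrite !in_cons !eqxx orbT.
- by rewrite !in_cons !eqxx orbT.
- by rewrite in_cons us orbT in_cons vs orbT.
Qed.

(** The edge leaving the first vertex contains that vertex, which does not occur later, so no later
    step repeats the edge. *)
Lemma uniq_walk_edges n (E : {set 'I_n * 'I_n}) s :
  sorted (bip_adj E) s -> uniq s -> uniq (walk_edges s).
Proof.
elim: s => // x [|y s] IHs // /andP[xy ys] /andP[xs us].
rewrite walk_edges_cons cons_uniq IHs // andbT.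
have exy : edge_of x y by case/bip_adjP: xy => ? ->.
by apply: contra xs => /(mem_walk_edges exy)/andP[].
Qed.

Lemma sorted_bip_adj n (E : {set 'I_n * 'I_n}) s :
  sorted (bip_adj E) s -> forall o, o \in walk_edges s -> exists2 ij, o = Some ij & ij \in E.
Proof.
elim: s => // x [|y s] IHs // /andP[/bip_adjP[ij xy ijE] ys] o.
rewrite walk_edges_cons in_cons => /orP[/eqP->|]; last exact: IHs.
by exists ij.
Qed.

(** One rotation step moves the first edge of the closed walk to its end. The default [x0] is read
    only when [s] is empty. *)
Lemma walk_edges_rot n i (s : seq ('I_n + 'I_n)) x0 :
  perm_eq (walk_edges (rcons (rot i s) (head x0 (rot i s))))
          (walk_edges (rcons s (head x0 s))).
Proof.
elim: i => [|i IHi]; first by rewrite rot0.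
case: (ltnP i (size s)) => [lt_is|le_si]; last by rewrite rot_oversize ?leqW.
rewrite rotS //; apply: perm_trans IHi.
case: {s lt_is}(rot i s) => [|x [|y s]] //.
rewrite rot1_cons.
have -> : walk_edges (rcons [:: x, y & s] (head x0 [:: x, y & s])) =
  edge_of x y :: walk_edges (y :: rcons s x) by [].
have -> : rcons (rcons (y :: s) x) (head x0 (rcons (y :: s) x)) =
  rcons (y :: rcons s x) y by [].
by rewrite walk_edges_rcons last_rcons perm_rcons.
Qed.

(** * Two further edges at the ends of a longest path *)

(** Deleting [S] loses exactly the induced edges touching [S]. As edges no longer outnumber vertices
    afterwards, more than [#|S|] edges are lost, too many for [L]. *)
Lemma induced_sub_excess n (E : {set 'I_n * 'I_n}) (D S : {set 'I_n + 'I_n}) :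
  S \subset D -> #|D| < #|induced_edges E D| -> #|induced_edges E (D :\: S)| <= #|D :\: S| ->
  forall L : seq (option ('I_n * 'I_n)), size L <= #|S| ->
  exists v w, [/\ v \in S, w \in D, bip_adj E v w & edge_of v w \notin L].
Proof.
move=> sSD exD exS L szL.
suff [ij]: exists ij, [&& ij \in induced_edges E D, (inl ij.1 \in S) || (inr ij.2 \in S)
    & Some ij \notin L].
  case: ij => i j /and3P[]; rewrite inE /= => /and3P[ijE iD jD] /orP[iS|jS] nL.
  - by exists (inl i), (inr j).
  - by exists (inr j), (inl i).
apply: contraPP exD => /forallNP noij; apply/negP; rewrite -leqNgt.
pose T := [set ij | Some ij \in L]%SET.
have cT : #|T| <= #|S|.
  apply: leq_trans szL; rewrite cardE.
  rewrite -(size_map Some); apply: uniq_leq_size.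
    by rewrite map_inj_uniq ?enum_uniq // => ? ? [].
  by move=> _ /mapP[ij + ->]; rewrite mem_enum inE.
rewrite -(cardsID S D) (finset.setIidPr sSD) addnC.
apply: leq_trans (leq_add exS cT).
apply: leq_trans (leq_card_setU _ _); apply: subset_leq_card; apply/fintype.subsetP => ij ijD.
rewrite inE; case: (boolP (ij \in T)) => [//|]; rewrite ?orbT ?orbF // inE => nL.
move/negP: (noij ij); rewrite ijD nL /= andbT negb_or => /andP[iS jS].
by move: ijD; rewrite !inE iS jS => /and3P[-> -> ->].
Qed.

Lemma longest_path (V : finType) (e : rel V) (D : {set V}) :
  exists s, [/\ uniq s, sorted e s, {subset s <= D} &
    forall s', uniq s' -> sorted e s' -> {subset s' <= D} -> size s' <= size s].
Proof.
pose P k := [exists s : k.-tuple V, [&& uniq s, sorted e s & all [in D] s]].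
have P0 : exists k, P k by exists 0; apply/existsP; exists [tuple].
have Pb k : P k -> k <= #|V|.
  by case/existsP=> s /andP[us _]; rewrite -(size_tuple s) -(card_uniqP us) max_card.
case: (ex_maxnP P0 Pb) => k /existsP[s /and3P[us ss /allP sD]] kmax.
exists s; split=> // s' us' ss' /allP sD'; rewrite size_tuple; apply: kmax.
by apply/existsP; exists (in_tuple s'); rewrite us' ss'.
Qed.

(* The walk [v :: rcons s w] encodes the path [s] with an additional edge at each
   of its ends.  Deleting vertices, we may assume that every set of vertices
   touches more edges than it has elements; then both ends of a longest path have
   a further neighbour, which lies on the path.  If the two additional edges
   coincide, the path closes up to a cycle, and a further edge at some vertex of
   the cycle serves after a rotation. *)
Lemma excess_walk n (E : {set 'I_n * 'I_n}) (D : {set 'I_n + 'I_n}) :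
  #|D| < #|induced_edges E D| ->
  exists v s w, [/\ sorted (bip_adj E) (v :: rcons s w),
    uniq (walk_edges (v :: rcons s w)), uniq s, v \in s & w \in s] /\ {subset s <= D}.
Proof.
move=> exD.
pose P (A : {set 'I_n + 'I_n}) := (A \subset D) && (#|A| < #|induced_edges E A|).
have PD : P D by rewrite /P subxx.
case: (arg_minnP (fun A : {set _} => #|A|) PD) => A /andP[sAD exA] Amin.
have extra (S : {set 'I_n + 'I_n}) (L : seq (option ('I_n * 'I_n))) :
    S \subset A -> S != finset.set0 -> size L <= #|S| ->
    exists v w, [/\ v \in S, w \in A, bip_adj E v w & edge_of v w \notin L].
  move=> sSA S0 szL; apply: induced_sub_excess => //.
  rewrite leqNgt; apply/negP => exS.
  have /Amin : P (A :\: S) by rewrite /P exS (fintype.subset_trans (finset.subsetDl _ _)).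
  rewrite leqNgt => /negP[]; rewrite -[ltnRHS](cardsID S A) (finset.setIidPr sSA).
  by rewrite -[ltnLHS]add0n ltn_add2r card_gt0.
have [s [us ss sA smax]] := longest_path (bip_adj E) A.
have s0 : 0 < size s.
  have : 0 < #|induced_edges E A| by apply: leq_trans exA.
  case/card_gt0P=> -[i j]; rewrite inE /= => /and3P[_ iA _].
  by apply: (smax [:: inl i]) => // x; rewrite inE => /eqP->.
have nbr x p : uniq (x :: p) -> sorted (bip_adj E) (x :: p) ->
    {subset x :: p <= A} -> size s = size (x :: p) ->
    forall w, w \in A -> bip_adj E w x -> w \in x :: p.
  move=> up sp pA szp w wA wx; apply/negP => /negP nw.
  have := smax (w :: x :: p); rewrite szp ltnn => smax'; apply: notF; apply: smax'.
  - by rewrite cons_uniq nw.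
  - by apply/andP.
  - by move=> z; rewrite in_cons => /orP[/eqP->//|/pA].
have ends x p : uniq (x :: p) -> sorted (bip_adj E) (x :: p) ->
    {subset x :: p <= A} -> size s = size (x :: p) ->
    exists w, [/\ w \in x :: p, bip_adj E w x & edge_of w x \notin walk_edges (x :: p)].
  move=> up sp pA szp.
  (* Only the first edge of the path meets [x], so avoiding it avoids the whole path; [take 1] also
     covers a path without edges. *)
  have [||//|v [w [/set1P-> wA xw xwL]]] :=
    @extra [set x]%SET (take 1 (walk_edges (x :: p))).
  - by rewrite finset.sub1set pA ?mem_head.
  - by rewrite -card_gt0 cards1.
  - by rewrite cards1 size_take; case: ifP => //; case: (size _) => [|[]].
  rewrite bip_adjC in xw; have wp := nbr x p up sp pA szp w wA xw.
  exists w; split=> //; rewrite edge_ofC; move: xwL up {sp pA szp wp nbr}.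
  have exw : edge_of x w by rewrite edge_ofC; case/bip_adjP: xw => ? ->.
  case: p => // y p; rewrite walk_edges_cons /= take0 inE => nxy /andP[xp _].
  rewrite in_cons (negPf nxy) /=; apply: contra xp.
  by move/(@mem_walk_edges _ (y :: p) _ _ exw)/andP=> [].
case: s us ss sA smax s0 nbr ends => // x p us ss sA smax _ nbr ends.
have [w1 [w1s w1x w1e]] := ends x p us ss sA erefl.
have [w2 [w2s w2y w2e]] : exists w, [/\ w \in x :: p, bip_adj E w (last x p) &
    edge_of w (last x p) \notin walk_edges (x :: p)].
  have : last x p = head x (rev (x :: p)).
    by elim/last_ind: (p) => // q z _; rewrite last_rcons -rcons_cons rev_rcons.
  have szr : size (rev (x :: p)) = size (x :: p) by rewrite size_rev.
  have ur : uniq (rev (x :: p)) by rewrite rev_uniq.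
  have sr : sorted (bip_adj E) (rev (x :: p)).
    by rewrite rev_sorted (eq_sorted (e' := bip_adj E)) // => ? ?; rewrite bip_adjC.
  have rA : {subset rev (x :: p) <= A} by move=> z; rewrite mem_rev => /sA.
  case Er: (rev (x :: p)) szr ur sr rA => [//|z q] szr ur sr rA /= ->.
  have [w [wq wz we]] := ends z q ur sr rA (esym szr).
  exists w; split=> //; first by rewrite -mem_rev Er.
  by move: we; rewrite -Er walk_edges_rev mem_rev.
have sD z : z \in x :: p -> z \in D by move/sA; apply: (fintype.subsetP sAD).
have [e12|e12] := eqVneq (edge_of w1 x) (edge_of (last x p) w2); last first.
  exists w1, (x :: p), w2; split=> //; split=> //.
    rewrite /= w1x; change (sorted (bip_adj E) (rcons (x :: p) w2)).
    by rewrite /= rcons_path bip_adjC w2y andbT.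
  rewrite rcons_cons walk_edges_cons -rcons_cons walk_edges_rcons.
  rewrite cons_uniq rcons_uniq mem_rcons in_cons negb_or e12 w1e.
  by rewrite edge_ofC w2e (uniq_walk_edges ss us).
have {w1 w1s w1x w1e w2 w2s w2y w2e e12} [yx yxe] : bip_adj E (last x p) x /\
    edge_of (last x p) x \notin walk_edges (x :: p).
  have e1 : edge_of w1 x by case/bip_adjP: w1x => ? ->.
  case: (edge_of_inj e1 e12) => [[<- _]//|[_ xE]].
  (* Here the path begins and ends at the same vertex, hence consists of [x] alone, and the extra
     edge would be a loop. *)
  case: p xE us {ss sA smax nbr ends w2 w2s w2y w2e e12 sD} w1s w1x w1e => [|y p] /=.
    by move=> _ _; rewrite inE => /eqP->; rewrite bip_adj_irrefl.
  by move=> {1}-> /andP[]; rewrite mem_last.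
(* The cycle has as many edges as vertices, so [extra] can avoid all of them. *)
have [||//|v [w [+ wA vw vwL]]] :=
  @extra [set z in x :: p]%SET (edge_of (last x p) x :: walk_edges (x :: p)).
- by apply/fintype.subsetP => z; rewrite inE => /sA.
- by apply/finset.set0Pn; exists x; rewrite inE mem_head.
- by rewrite cardsE (card_uniqP us) /= size_pairmap.
rewrite inE => vs; have [i t rot_s] := rot_to vs.
have perm_t : perm_eq (v :: t) (x :: p) by rewrite -rot_s perm_rot.
have ut : uniq (v :: t) by rewrite (perm_uniq perm_t).
have ct : cycle (bip_adj E) (v :: t).
  by rewrite -rot_s rot_cycle /= rcons_path yx andbT.
have tA : {subset v :: t <= A} by move=> z; rewrite (perm_mem perm_t) => /sA.
(* Opened at [v], the cycle is again a longest path, so the neighbour [w] of its end lies on it. *)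
have wt : w \in v :: t.
  apply: nbr => //; last by rewrite bip_adjC.
  - by move: ct; rewrite /= rcons_path => /andP[].
  - by rewrite (perm_size perm_t).
have := walk_edges_rot i (x :: p) x; rewrite rot_s => perm_e.
exists w, (v :: t), v; split; last by move=> z /tA; apply: (fintype.subsetP sAD).
split=> //; last exact: mem_head.
- by rewrite /= bip_adjC vw.
- rewrite rcons_cons walk_edges_cons cons_uniq -rcons_cons edge_ofC.
  rewrite (perm_uniq perm_e) (perm_mem perm_e) [head _ _]/= walk_edges_rcons.
  rewrite mem_rcons rcons_uniq vwL yxe.
  exact: uniq_walk_edges ss us.
Qed.

(** * Components, spanning trees and witnesses of excess *)

Definition bip_comp n (E : {set 'I_n * 'I_n}) x : {set 'I_n + 'I_n} :=
  [set y | connect (bip_adj E) x y]%SET.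

Lemma bip_connectC n (E : {set 'I_n * 'I_n}) : connect_sym (bip_adj E).
Proof. by apply: sym_connect_sym; apply: bip_adjC. Qed.

Lemma connect_bip_sub n (E E' : {set 'I_n * 'I_n}) u v :
  E \subset E' -> connect (bip_adj E) u v -> connect (bip_adj E') u v.
Proof.
move=> /fintype.subsetP sE; apply: connect_sub => {u v} u v /bip_adjP[ij uv ijE].
by apply/connect1/bip_adjP; exists ij => //; apply: sE.
Qed.

Lemma mem_bip_comp n (E : {set 'I_n * 'I_n}) x y :
  y \in bip_comp E x -> bip_comp E y = bip_comp E x.
Proof.
rewrite inE => xy; apply/setP => z; rewrite !inE.
by rewrite (same_connect (@bip_connectC n E) xy).
Qed.

Lemma mem_induced_edges n (E : {set 'I_n * 'I_n}) (C : {set 'I_n + 'I_n}) u v ij :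
  edge_of u v = Some ij -> u \in C -> v \in C -> ij \in E -> ij \in induced_edges E C.
Proof.
by case: u v => [i|i] [j|j] //= [<-] uC vC ijE; rewrite inE ijE /= ?uC ?vC.
Qed.

(** The tree grows from [x] by one outgoing edge and its outer end at a time. It is encoded as an
    edge set that connects the component and has one edge fewer than vertices. *)
Lemma spanning_tree n (E : {set 'I_n * 'I_n}) x :
  exists T : {set 'I_n * 'I_n}, [/\ T \subset induced_edges E (bip_comp E x),
    #|T|.+1 = #|bip_comp E x| & bip_comp T x = bip_comp E x].
Proof.
set C := bip_comp E x; have xC : x \in C by rewrite inE.
suff partial k : k < #|C| -> exists (S : {set 'I_n + 'I_n}) (T : {set 'I_n * 'I_n}),
    [/\ S \subset C, #|S| = k.+1, T \subset induced_edges E S, #|T| = k &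
    x \in S /\ forall y, y \in S -> connect (bip_adj T) x y].
  have C0 : 0 < #|C| by apply/card_gt0P; exists x.
  have [|S [T [sSC cS sTE cT [_ TS]]]] := partial #|C|.-1; first by rewrite prednK.
  have SC : S = C by apply/eqP; rewrite eqEcard sSC cS prednK ?leqnn.
  exists T; rewrite SC in sTE; split=> //; first by rewrite cT prednK.
  apply/setP => y; apply/idP/idP => [|yC]; last by rewrite inE TS // SC.
  rewrite !inE; apply: connect_bip_sub; apply: fintype.subset_trans sTE _.
  by apply/fintype.subsetP => ij; rewrite inE => /andP[].
elim: k => [_|k IHk lt_kC].
  exists [set x]%SET, (@finset.set0 _); split; rewrite ?finset.sub1set ?cards1 ?cards0 //.
  - exact: finset.sub0set.
  by split=> [|y /set1P->]; rewrite ?inE.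
have [S [T [sSC cS sTE cT [xS TS]]]] := IHk (ltnW lt_kC).
have [u [v [uS vS uv]]] : exists u v, [/\ u \in S, v \notin S & bip_adj E u v].
  apply: contrapT => noE.
  have cl : fingraph.closed (bip_adj E) (mem S).
    apply: (intro_closed (@bip_connectC n E)) => u v uv uS.
    by apply: contrapT => /negP vS; apply: noE; exists u, v.
  have : C \subset S.
    apply/fintype.subsetP => y; rewrite inE => /(closed_connect cl).
    by rewrite xS.
  by move/subset_leq_card; rewrite cS leqNgt lt_kC.
have uC : u \in C by apply: (fintype.subsetP sSC).
have vC : v \in C.
  by move: uC; rewrite !inE => xu; apply: connect_trans xu (connect1 uv).
have [ij uvE ijE] := bip_adjP _ _ _ uv.
have TijT : T \subset ij |: T by apply: finset.subsetUr.
have conS y : y \in S -> connect (bip_adj (ij |: T)) x y.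
  by move=> yS; apply: connect_bip_sub TijT _; apply: TS.
exists (v |: S), (ij |: T); split.
- by rewrite finset.subUset finset.sub1set vC.
- by rewrite cardsU1 vS cS.
- rewrite finset.subUset finset.sub1set (mem_induced_edges uvE) ?setU11 ?setU1r //=.
  apply: fintype.subset_trans sTE _; apply/fintype.subsetP => kl; rewrite !inE.
  by case/and3P=> -> -> ->; rewrite !orbT.
- rewrite cardsU1 cT; case: (boolP (ij \in T)) => // /(fintype.subsetP sTE).
  rewrite inE => /and3P[_ iS jS]; case/negP: vS; move: uvE iS jS.
  by case: (u) (v) => [?|?] [?|?] //= [<-].
- split=> [|y /setU1P]; first by rewrite !inE xS orbT.
  move=> [->|/conS//]; apply: connect_trans (conS u uS) (connect1 _).
  by apply/bip_adjP; exists ij; rewrite // setU11.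
Qed.

Lemma card_between (T : finType) (A B : {set T}) k :
  A \subset B -> #|A| <= k <= #|B| ->
  exists F : {set T}, [/\ A \subset F, F \subset B & #|F| = k].
Proof.
move=> sAB; elim: k => [|k IHk].
  rewrite leqn0 cards_eq0 => /andP[/eqP-> _]; exists finset.set0.
  by split; rewrite ?finset.sub0set ?cards0.
case: (ltngtP #|A| k.+1) => [ltAk /= ltkB|//|<- _]; last by exists A.
have [|F [sAF sFB cF]] := IHk; first by rewrite -ltnS ltAk ltnW.
have /fintype.subsetPn[z zB zF] : ~~ (B \subset F).
  by apply/negP => /subset_leq_card; rewrite cF leqNgt ltkB.
exists (z |: F); rewrite finset.subUset finset.sub1set zB sFB cardsU1 zF cF; split=> //.
exact: fintype.subset_trans sAF (finset.subsetUr _ _).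
Qed.

Definition excess_comp n (E : {set 'I_n * 'I_n}) (C : {set 'I_n + 'I_n}) : bool :=
  [exists x, C == bip_comp E x] && (#|C| < #|induced_edges E C|).

(** Between [F] and [E] the component stays [C]: a spanning tree in [F] connects it, and no edge of
    [E] leaves it. The edges of [F] alone outnumber the vertices. This is the kind of witness that
    [edge_weight_thinning] asks for. *)
Lemma excess_core n (E : {set 'I_n * 'I_n}) (C : {set 'I_n + 'I_n}) :
  excess_comp E C -> exists F : {set 'I_n * 'I_n}, [/\ F \subset E, #|F| = #|C|.+1 &
    forall E' : {set 'I_n * 'I_n}, F \subset E' -> E' \subset E -> excess_comp E' C].
Proof.
case/andP=> /existsP[x /eqP->] exC; have [T [sTE cT TC]] := spanning_tree E x.
have [|F [sTF sFE cF]] := card_between (k := #|bip_comp E x|.+1) sTE.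
  by rewrite exC -cT ltnW.
have sIE : induced_edges E (bip_comp E x) \subset E.
  by apply/fintype.subsetP => ij; rewrite inE => /andP[].
exists F; split=> // [|E' sFE' sE'E]; first exact: fintype.subset_trans sFE sIE.
apply/andP; split.
  apply/existsP; exists x; rewrite finset.eqEsubset -{1}TC.
  apply/andP; split; apply/fintype.subsetP => y; rewrite !inE.
  - by apply: connect_bip_sub; apply: fintype.subset_trans sTF sFE'.
  - exact: connect_bip_sub.
rewrite -cF; apply: subset_leq_card; apply/fintype.subsetP => ij ijF.
have := fintype.subsetP sFE _ ijF; rewrite !inE => /andP[_ ->].
by rewrite (fintype.subsetP sFE').
Qed.

(** The rest of the cycle joins the ends of the deleted edge and replaces it in every path. *)
Lemma connect_cycle_edge n (E : {set 'I_n * 'I_n}) c z ij u v :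
  graph_cycle (bip_adj E) c -> z \in c -> edge_of z (next c z) = Some ij ->
  connect (bip_adj E) u v -> connect (bip_adj (E :\ ij)) u v.
Proof.
move=> /andP[/andP[cc uc] sc] zc zij.
suff zw : connect (bip_adj (E :\ ij)) z (next c z).
  apply: connect_sub => {u v} u v /bip_adjP[kl uv klE].
  have [e|ne] := eqVneq kl ij; last first.
    by apply/connect1/bip_adjP; exists kl; rewrite // !inE ne.
  rewrite e -zij in uv; have uvE : edge_of u v by rewrite uv zij.
  by case: (edge_of_inj uvE uv) => -[-> ->]; rewrite // bip_connectC.
have [i s rs] := rot_to zc.
have nz : next c z = head z s.
  by rewrite -(next_rot i uc) rs; case: (s) => [|y t] /=; rewrite eqxx.
have ur : uniq (z :: s) by rewrite -rs rot_uniq.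
have : cycle (bip_adj E) (z :: s) by rewrite -rs rot_cycle.
have : 2 < size (z :: s) by rewrite -rs size_rot.
rewrite nz in zij *; case: s {rs nz} ur zij => [//|w s] ur /= zij s0.
rewrite bip_connectC => /= /andP[zw pws].
have zijE : edge_of z w by rewrite zij.
apply/connectP; exists (rcons s z); last by rewrite last_rcons.
(* Inner edges of the rest miss [z]; the last one returns to [z] from a vertex other than [w],
   because the cycle has more than two vertices. *)
have nE : Some ij \notin walk_edges (w :: rcons s z).
  rewrite -zij -rcons_cons walk_edges_rcons mem_rcons inE negb_or.
  case/and3P: ur => zws ws us; apply/andP; split.
    apply/eqP => /(edge_of_inj zijE)[[_ wz]|[_ wl]].
      by move: zws; rewrite -wz mem_head.
    case: s s0 ws wl {pws zws us} => // y s _ /negP ws wl; apply: ws.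
    by rewrite {1}wl /= mem_last.
  by apply: contra zws => /(mem_walk_edges zijE)/andP[].
elim: (rcons s z) w pws nE {ur zij s0 zw zijE} => // y t IHt w /andP[wy yt].
rewrite walk_edges_cons in_cons negb_or => /andP[nwy nyt] /=.
rewrite IHt // andbT; case/bip_adjP: wy => kl wy klE.
apply/bip_adjP; exists kl; rewrite // !inE klE andbT.
by apply: contraNneq nwy => <-; rewrite wy.
Qed.

(** After exchanging the cycles if necessary, some edge [h] of the first is not in the second. The
    second cycle survives the removal of [h] and can lose an edge [g] in turn. A spanning tree of
    what remains, with [h] and [g], has one more edge than vertices. *)
Lemma complex_excess n (E : {set 'I_n * 'I_n}) (C : {set 'I_n + 'I_n}) :
  complex_component (bip_adj E) C -> excess_comp E C.
Proof.
case=> -[x ->] [c1 [c2 [gc1 gc2 sc1 sc2 c12]]].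
rewrite -/(bip_comp E x) in sc1 sc2 *.
apply/andP; split; first by apply/existsP; exists x.
wlog sub12 : c1 c2 gc1 gc2 sc1 sc2 {c12} / ~~ (cycle_edges c1 \subset cycle_edges c2).
  move=> wl; have [s12|] := boolP (cycle_edges c1 \subset cycle_edges c2); last exact: wl.
  apply: (wl c2 c1) => //; apply/negP => s21; apply: c12; apply/eqP.
  by rewrite finset.eqEsubset s12.
case/fintype.subsetPn: sub12 => _ /imsetP[z zc1 ->] zc2.
have adj1 := next_cycle (proj1 (andP (proj1 (andP gc1)))) zc1.
have [h zh hE] := bip_adjP _ _ _ adj1.
have adj2 y : y \in c2 -> bip_adj (E :\ h) y (next c2 y).
  move=> yc2; have := next_cycle (proj1 (andP (proj1 (andP gc2)))) yc2.
  case/bip_adjP=> g yg gE; apply/bip_adjP; exists g => //; rewrite !inE gE andbT.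
  apply: contraNneq zc2 => gh; rewrite gh -zh in yg; apply/imsetP; exists y => //.
  have yE : edge_of y (next c2 y) by rewrite yg zh.
  by case: (edge_of_inj yE yg) => -[-> ->]; rewrite // finset.setUC.
have gc2' : graph_cycle (bip_adj (E :\ h)) c2.
  case/andP: gc2 => /andP[_ u2] s2; rewrite /graph_cycle s2 andbT /ucycleb u2 andbT.
  exact: cycle_from_next.
have [y yc2] : exists y, y \in c2.
  by case: (c2) gc2 => [/andP[]//|y s _]; exists y; rewrite mem_head.
have [g yg gE] := bip_adjP _ _ _ (adj2 y yc2).
have conE : bip_comp (E :\ h :\ g) x = bip_comp E x.
  apply/setP => v; rewrite !inE; apply/idP/idP.
    by apply: connect_bip_sub; rewrite (fintype.subset_trans (subD1set _ _)) ?subD1set.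
  move=> xv; apply: (connect_cycle_edge gc2' yc2 yg).
  exact: (connect_cycle_edge gc1 zc1 zh).
have [T [sT cT _]] := spanning_tree (E :\ h :\ g) x; rewrite conE in sT cT.
have gI : g \in induced_edges E (bip_comp E x).
  apply: mem_induced_edges yg _ _ _; rewrite ?sc2 ?mem_next //.
  by move: gE; rewrite inE => /andP[].
have hI : h \in induced_edges E (bip_comp E x).
  by apply: mem_induced_edges zh _ _ _; rewrite ?sc1 ?mem_next.
have gh : g != h by move: gE; rewrite !inE => /andP[].
rewrite (cardsD1 h) hI (cardsD1 g) finset.in_setD1 gh gI -cT !add1n !ltnS.
apply: subset_leq_card; apply: fintype.subset_trans sT _.
by apply/fintype.subsetP => ij; rewrite !inE -!andbA => /and5P[-> -> -> -> ->].
Qed.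

(** * Product measures on the subsets of a finite type *)

(** For constant [P] this is [bip_weight]. A varying [P] serves to give the pairs of a cut
    probability [0]. *)
Definition edge_weight (R : comRingType) (I : finType) (P : I -> R) (E : {set I}) : R :=
  (\prod_i (if i \in E then P i else 1 - P i))%R.

Lemma edge_weight_ge0 (R : realFieldType) (I : finType) (P : I -> R) E :
  (forall i, 0 <= P i <= 1)%R -> (0 <= edge_weight P E)%R.
Proof.
move=> P01; apply: prodr_ge0 => i _; have /andP[P0 P1] := P01 i.
by case: ifP => _; rewrite ?subr_ge0.
Qed.

(** Expand the product of [P i + (1 - P i)], with the second term replaced by [0] for [i] in [F]:
    the sets that contain [F] survive. *)
Lemma sum_edge_weight_sup (R : comRingType) (I : finType) (P : I -> R) (F : {set I}) :
  (\sum_(E : {set I} | F \subset E) edge_weight P E = \prod_(i in F) P i)%R.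
Proof.
rewrite big_mkcond [RHS]big_mkcond /=.
transitivity (\prod_i (P i + (if i \in F then 0 else 1 - P i)))%R; last first.
  by apply: eq_bigr => i _; case: ifP => _; rewrite ?addr0 // addrC subrK.
rewrite bigA_distr; apply: eq_bigr => E _; case: ifPn => [sFE|/fintype.subsetPn[i iF iE]].
  apply: eq_bigr => i _; case: ifPn => // iE; case: ifPn => // iF.
  by move: iE; rewrite (fintype.subsetP sFE).
by rewrite (bigD1 i) //= (negPf iE) iF mul0r.
Qed.

Lemma sum_edge_weight (R : comRingType) (I : finType) (P : I -> R) :
  (\sum_(E : {set I}) edge_weight P E = 1)%R.
Proof.
rewrite -[RHS](big_set0 1%R *%R P) -sum_edge_weight_sup.
by apply: eq_bigl => E; rewrite finset.sub0set.
Qed.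

(* Keeping each element of a random set of law [P] independently with probability
   [q] gives a set of law [P * q]; if the random set lies in [A], then it remains
   in [A] as soon as the [r] elements of a witness are kept. *)
Lemma edge_weight_thinning (R : realFieldType) (I : finType) (P : I -> R) (q : R)
    (A : pred {set I}) (r : nat) :
  (forall i, 0 <= P i <= 1)%R -> (0 <= q <= 1)%R ->
  (forall E, A E -> exists F : {set I}, [/\ F \subset E, #|F| = r &
     forall E' : {set I}, F \subset E' -> E' \subset E -> A E']) ->
  (q ^+ r * \sum_(E | A E) edge_weight P E <=
   \sum_(E | A E) edge_weight (fun i => P i * q) E)%R.
Proof.
move=> P01 /andP[q0 q1] Acore.
(* The joint weight of a set [E1] of law [P] and its thinned subset [E]. *)
pose K (E1 E : {set I}) : R := (\prod_i if i \in E1 then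
  P i * (if i \in E then q else 1 - q) else (if i \in E then 0 else 1 - P i))%R.
have K0 E1 E : (0 <= K E1 E)%R.
  apply: prodr_ge0 => i _; have /andP[P0 P1] := P01 i.
  by do 2 case: ifP => _ //; rewrite ?mulr_ge0 ?subr_ge0.
have KE E : edge_weight (fun i => P i * q)%R E = (\sum_E1 K E1 E)%R.
  rewrite /K -bigA_distr; apply: eq_bigr => i _ /=; case: (i \in E); first by rewrite addr0.
  by ring.
rewrite [leRHS](eq_bigr _ (fun E _ => KE E)) exchange_big /= mulr_sumr.
rewrite [leLHS]big_mkcond /=; apply: ler_sum => E1 _.
case: ifP => [/Acore[F [sFE1 <- FA]]|_]; last by apply: sumr_ge0 => E _; apply: K0.
apply: (@le_trans _ _ (\sum_(E : {set I} | (F \subset E) && (E \subset E1)) K E1 E)%R); last first.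
  rewrite big_mkcond [leRHS]big_mkcond /=; apply: ler_sum => E _.
  case: ifP => [/andP[sFE sEE1]|_]; last by case: ifP.
  by rewrite FA.
rewrite le_eqVlt; apply/orP; left; apply/eqP.
(* Summing over [E] between [F] and [E1] factors over [i]: an element of [F] must be kept and gives
   [P i * q], another element of [E1] gives [P i], and the rest give [1 - P i]. *)
transitivity (\prod_i ((if i \in E1 then P i * q else 0) +
  (if i \in F then 0 else if i \in E1 then P i * (1 - q) else 1 - P i)))%R.
  rewrite -prodr_const [X in (X * _)%R]big_mkcond -big_split /=; apply: eq_bigr => i _.
  case: ifPn => [iF|_]; first by rewrite (fintype.subsetP sFE1) // addr0 mulrC.
  case: ifP => _; last by rewrite mul1r add0r.
  by rewrite -mulrDr addrC subrK mulr1 mul1r.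
rewrite bigA_distr [RHS]big_mkcond /=; apply: eq_bigr => E _.
case: ifPn => [/andP[sFE sEE1]|].
  apply: eq_bigr => i _; case: (boolP (i \in E)) => [iE|iE].
    by rewrite (fintype.subsetP sEE1).
  by rewrite ifN //; apply: contra iE; apply: (fintype.subsetP sFE).
rewrite negb_and => /orP[] /fintype.subsetPn[i i1 i2]; rewrite (bigD1 i) //=.
- by rewrite (negPf i2) i1 mul0r.
- by rewrite i1 (negPf i2) mul0r.
Qed.

(** Each pair of [K] is absent and contributes [1 - p]; in the law with probability [0] on [K] it
    contributes [1]. *)
Lemma edge_weight_avoid (R : comRingType) (I : finType) (p : R) (K : {set I})
    (A : pred {set I}) :
  (forall E, A E -> [disjoint K & E]) ->
  (\sum_(E | A E) edge_weight (fun=> p) E = (1 - p) ^+ #|K| *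
   \sum_(E | A E) edge_weight (fun i => if i \in K then 0 else p) E)%R.
Proof.
move=> AK; rewrite mulr_sumr; apply: eq_bigr => E /AK dKE.
rewrite -prodr_const [X in (X * _)%R]big_mkcond -big_split /=; apply: eq_bigr => i _.
have [iK|iK] := boolP (i \in K); last by rewrite mul1r.
by rewrite (disjointFr dKE iK) subr0 mulr1.
Qed.

(** * Counting configurations in the random graph *)

(** A path is determined by the class of its first vertex and by the labels along it, which gives
    [2 * n ^ m] candidates instead of [(2 * n) ^ m]. *)
Fixpoint alternate n (b : bool) (s : seq 'I_n) : seq ('I_n + 'I_n) :=
  if s is i :: s' then (if b then inl i else inr i) :: alternate (~~ b) s' else [::].

Lemma size_alternate n b (s : seq 'I_n) : size (alternate b s) = size s.
Proof. by elim: s b => //= i s IHs b; rewrite IHs. Qed.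

Lemma sorted_alternate n (E : {set 'I_n * 'I_n}) s :
  sorted (bip_adj E) s -> exists b t, s = alternate b t.
Proof.
case: s => [|v s] sv; first by exists true, [::].
suff [t ->] : exists t, v :: s = alternate (if v is inl _ then true else false) t.
  by eexists; exists t.
elim: s v sv => [|w s IHs] v; first by
  move=> _; exists [:: match v with inl i | inr i => i end]; case: v.
case/andP=> vw /IHs[t ->]; exists (match v with inl i | inr i => i end :: t).
by case: v w vw => [i|i] [j|j].
Qed.

(* A path of [m] vertices alternating between the two classes, with the positions
   on it of the two neighbours to which its ends are joined. *)
Definition chorded n m := (bool * m.-tuple 'I_n * 'I_m * 'I_m)%type.

(** As ['I_n] may be empty, the default of [nth] is built from [t] itself; the position [i] is
    always in range. *)
Definition chorded_root n m (x : chorded n m) : 'I_n + 'I_n :=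
  let: (b, t, i, j) := x in nth (inl (tnth t i)) (alternate b t) i.

Definition chorded_walk n m (x : chorded n m) : seq ('I_n + 'I_n) :=
  let: (b, t, i, j) := x in
  chorded_root x :: rcons (alternate b t) (nth (inl (tnth t i)) (alternate b t) j).

Definition chorded_edges n m (x : chorded n m) : {set 'I_n * 'I_n} :=
  [set ij | Some ij \in walk_edges (chorded_walk x)]%SET.

Definition chorded_proper n m (x : chorded n m) : bool :=
  uniq (walk_edges (chorded_walk x)) && all isSome (walk_edges (chorded_walk x)).

Lemma card_chorded_edges n m (x : chorded n m) :
  chorded_proper x -> #|chorded_edges x| = m.+1.
Proof.
case/andP=> ux sx.
have -> : m.+1 = size (walk_edges (chorded_walk x)).
  rewrite size_walk_edges; case: x {ux sx} => [[[b t] i] j] /=.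
  by rewrite size_rcons size_alternate size_tuple.
rewrite -(card_uniqP ux) -(card_imset _ (@Some_inj _)); apply: eq_card => o.
apply/imsetP/idP => [[ij + ->]|ox]; first by rewrite inE.
by case: o ox (allP sx _ ox) => // ij ox _; exists ij; rewrite ?inE.
Qed.

(** The configuration comes from [excess_walk], and [m] is at most [n + n] since the path has
    distinct vertices. As [E] and the root determine [C], configurations can be counted in place of
    components. *)
Lemma excess_comp_chorded n (E : {set 'I_n * 'I_n}) (C : {set 'I_n + 'I_n}) :
  excess_comp E C -> exists (m : 'I_(n + n).+1) (x : chorded n m),
    [/\ chorded_proper x, chorded_edges x \subset E &
        C = bip_comp E (chorded_root x)].
Proof.
case/andP=> /existsP[r /eqP CE] /excess_walk[v [s [w [[sw uw us vs ws] sC]]]].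
have ss : sorted (bip_adj E) s.
  by move: sw => /=; rewrite -cats1; case: (s) => //= y t /andP[_]; rewrite cat_path => /andP[].
have [b [t st]] := sorted_alternate ss.
have szs : size s < (n + n).+1.
  by rewrite ltnS -(card_uniqP us) (leq_trans (max_card _)) // card_sum card_ord.
have szt : size t == size s by rewrite st size_alternate.
have vi : index v s < size s by rewrite index_mem.
have wj : index w s < size s by rewrite index_mem.
pose x : chorded n (Ordinal szs) := (b, Tuple szt, Ordinal vi, Ordinal wj).
have xE : chorded_walk x = v :: rcons s w.
  by rewrite /chorded_walk /= -st !nth_index.
exists (Ordinal szs), x; split.
- rewrite /chorded_proper xE uw; apply/allP => o.
  by case/(sorted_bip_adj sw) => ij ->.
- apply/fintype.subsetP => ij; rewrite inE xE => /(sorted_bip_adj sw).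
  by case=> kl [->].
- by rewrite CE /= -st nth_index // (mem_bip_comp (x := r)) // -CE sC.
Qed.

Lemma expected_excess_comp (R : realFieldType) n (p : R) : (0 <= p <= 1)%R ->
  (\sum_(C : {set 'I_n + 'I_n}) \sum_(E : {set 'I_n * 'I_n} | excess_comp E C)
     edge_weight (fun=> p) E <=
   \sum_(m < (n + n).+1) (2 * n ^ m * m ^ 2)%:R * p ^+ m.+1)%R.
Proof.
move=> p01; have w0 E := edge_weight_ge0 E (fun _ : 'I_n * 'I_n => p01).
rewrite (exchange_big_dep predT) //=.
pose Z := {m : 'I_(n + n).+1 & chorded n m}.
pose good (z : Z) := chorded_proper (tagged z).
apply: (@le_trans _ _ (\sum_(E : {set 'I_n * 'I_n})
   \sum_(z : Z | good z && (chorded_edges (tagged z) \subset E)) edge_weight (fun=> p) E)%R).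
  apply: ler_sum => E _; rewrite !sumr_const ler_wpMn2l //.
  pose Q : pred Z := fun z => good z && (chorded_edges (tagged z) \subset E).
  apply: (@leq_trans #|[set bip_comp E (chorded_root (tagged z)) | z in Q]%SET|); last first.
    exact: leq_imset_card.
  apply: subset_leq_card; apply/fintype.subsetP => C; rewrite unfold_in /=.
  case/excess_comp_chorded=> m [x [gx sxE ->]]; apply/imsetP.
  by exists (Tagged (fun m : 'I_(n + n).+1 => chorded n m) x); rewrite // unfold_in /Q /good /= gx.
rewrite (exchange_big_dep good) /=; last by move=> ? z _ /andP[].
(* A proper configuration has [m + 1] distinct edges, so it is present with probability
   [p ^+ m.+1]. *)
rewrite (eq_bigr (fun z : Z => p ^+ (tag z).+1)%R); last first.
  move=> z gz; rewrite -(card_chorded_edges gz) -prodr_const -sum_edge_weight_sup.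
  by apply: eq_bigl => E; rewrite gz.
apply: (@le_trans _ _ (\sum_(z : Z) p ^+ (tag z).+1)%R).
  rewrite big_mkcond; apply: ler_sum => z _; case: ifP => // _.
  by case/andP: p01 => p0 _; rewrite exprn_ge0.
rewrite -(@sig_big_dep _ _ _ _ (fun m : 'I_(n + n).+1 => chorded n m : finType)
  predT (fun _ => predT) (fun m _ => p ^+ m.+1)%R) /=.
apply: ler_sum => m _; rewrite sumr_const !card_prod card_bool card_tuple !card_ord.
by rewrite mulr_natl -!mulnA.
Qed.

(** * Cuts and the comparison of two edge probabilities *)

Definition cut_edges n (C : {set 'I_n + 'I_n}) : {set 'I_n * 'I_n} :=
  [set ij | (inl ij.1 \in C) != (inr ij.2 \in C)]%SET.

Lemma excess_comp_disjoint_cut n (E : {set 'I_n * 'I_n}) (C : {set 'I_n + 'I_n}) :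
  excess_comp E C -> [disjoint cut_edges C & E].
Proof.
case/andP=> /existsP[x /eqP->] _; rewrite disjoint_sym; apply/pred0P => -[i j] /=.
apply/andP => -[ijE]; rewrite !inE /= => /negP[]; apply/eqP.
have adj : bip_adj E (inl i) (inr j) by [].
exact: (same_connect_r (@bip_connectC n E) (connect1 adj)).
Qed.

(** With [a] and [b] vertices of [C] in the two classes, the cut has [a * (n - b) + b * (n - a)]
    pairs, and [4 * a * b <= (a + b) ^ 2]. *)
Lemma card_cut_edges n (C : {set 'I_n + 'I_n}) :
  2 * n * #|C| <= 2 * #|cut_edges C| + #|C| ^ 2.
Proof.
pose a := \sum_(i < n) (inl i \in C : nat); pose b := \sum_(i < n) (inr i \in C : nat).
have cC : #|C| = a + b.
  by rewrite -sum1_card big_mkcond big_sumType /=; congr (_ + _); apply: eq_bigr => i _; case: ifP.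
have : #|cut_edges C| + 2 * (a * b) = n * a + n * b.
  rewrite big_distrlr /= big_distrr /= -sum1_card big_mkcond /=.
  rewrite (eq_bigr (fun ij => ((inl ij.1 \in C) != (inr ij.2 \in C) : nat))); last first.
    by move=> ij _; rewrite inE; case: (_ != _).
  rewrite -(pair_big xpredT xpredT (fun i j => ((inl i \in C) != (inr j \in C) : nat))) /=.
  rewrite -big_split /=.
  transitivity (\sum_(i < n) \sum_(j < n) ((inl i \in C) + (inr j \in C) : nat)).
    apply: eq_bigr => i _; rewrite big_distrr /= -big_split /=; apply: eq_bigr => j _.
    by case: (inl i \in C); case: (inr j \in C).
  under eq_bigr do rewrite big_split /= sum_nat_const card_ord.
  by rewrite big_split /= -big_distrr /= sum_nat_const card_ord.
rewrite cC; have [] := nat_AGM2 a b.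
clearbody a b; move: (a * b) ((a + b) ^ 2) => ab s; rewrite mulnDr; nia.
Qed.

(** The cut contributes an exact power of [1 - p] or [1 - p * q]. Only the other pairs are thinned,
    at the cost of one factor [q] for each of the [#|C|.+1] edges of a witness. *)
Lemma excess_comp_thinning (R : realFieldType) n (p q : R) (C : {set 'I_n + 'I_n}) :
  (0 <= p <= 1)%R -> (0 <= q <= 1)%R ->
  (q ^+ #|C|.+1 * (1 - p * q) ^+ #|cut_edges C| *
     \sum_(E : {set 'I_n * 'I_n} | excess_comp E C) edge_weight (fun=> p) E <=
   (1 - p) ^+ #|cut_edges C| *
     \sum_(E : {set 'I_n * 'I_n} | excess_comp E C) edge_weight (fun=> p * q) E)%R.
Proof.
move=> p01 q01; have disj E := @excess_comp_disjoint_cut n E C.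
have [p0 p1] := andP p01; have [q0 q1] := andP q01.
rewrite (edge_weight_avoid p disj) (edge_weight_avoid (p * q)%R disj).
have pq1 : (p * q <= 1)%R by rewrite mulr_ile1.
have P01 (i : 'I_n * 'I_n) : (0 <= (if i \in cut_edges C then 0 else p) <= 1)%R.
  by case: ifP => // _; rewrite lexx ler01.
have c0 : (0 <= (1 - p * q) ^+ #|cut_edges C| * (1 - p) ^+ #|cut_edges C|)%R.
  by rewrite mulr_ge0 // exprn_ge0 // subr_ge0.
have := ler_wpM2l c0 (edge_weight_thinning P01 q01 (@excess_core n ^~ C)).
set S1 := (\sum_(E | _) _)%R; set S2 := (\sum_(E | _) _)%R; set S3 := (\sum_(E | _) _)%R.
have -> : S2 = S3.
  apply: eq_bigr => E _; apply: eq_bigr => ij _; case: ifP => _ //.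
    by case: ifP; rewrite ?mul0r.
  by case: ifP; rewrite ?mul0r.
by congr (_ <= _)%R; ring.
Qed.

(** * The subcritical expectation *)

(** The terms are dominated by those of the second derivative of the geometric series, whose sum is
    [2 / (1 - r) ^+ 3]. For partial sums, an explicit nonnegative remainder is verified by
    induction. *)
Lemma sum_sqr_geometric (R : realFieldType) (r : R) N : (0 <= r < 1)%R ->
  (\sum_(m < N) (m ^ 2)%:R * r ^+ m.+1 <= 2 / (1 - r) ^+ 3)%R.
Proof.
case/andP=> r0 r1; have r10 : (0 < 1 - r)%R by rewrite subr_gt0.
rewrite ler_pdivlMr ?exprn_gt0 //.
pose S := (\sum_(m < N) (m.+1 * m.+2)%:R * r ^+ m)%R.
have leS : (\sum_(m < N) (m ^ 2)%:R * r ^+ m.+1 <= S)%R.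
  apply: ler_sum => m _; apply: ler_pM; rewrite ?ler0n ?exprn_ge0 ?ler_nat //.
    by rewrite -mulnn; nia.
  by rewrite exprS ler_piMl ?exprn_ge0 // ltW.
apply: le_trans (ler_wpM2r (exprn_ge0 3 (ltW r10)) leS) _.
have : (S * (1 - r) ^+ 3 + r ^+ N *
    (N%:R ^+ 2 * (1 - r) ^+ 2 + N%:R * (1 - r) * (3 - r) + 2) = 2)%R.
  rewrite /S; elim: N {S leS} => [|N IHN]; first by rewrite big_ord0 expr0; ring.
  rewrite big_ord_recr /= -[RHS]IHN natrM [(r ^+ N.+1)%R]exprS -[N.+2]addn2 -[N.+1]addn1 !natrD.
  move: (\sum_(_ < _) _)%R (r ^+ N)%R (N%:R : R)%R => S t x {IHN}; ring.
have : (0 <= r ^+ N * (N%:R ^+ 2 * (1 - r) ^+ 2 + N%:R * (1 - r) * (3 - r) + 2))%R.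
  rewrite mulr_ge0 ?exprn_ge0 // !addr_ge0 ?mulr_ge0 ?exprn_ge0 ?ler0n //; lra.
by move=> ? <-; rewrite lerDl.
Qed.

(** The factor [n ^ m] cancels against [p ^+ m.+1] up to [1 / n], leaving the series of
    [sum_sqr_geometric] at [r = 1 - d]. *)
Lemma expected_excess_comp_subcritical (R : realFieldType) n (d : R) :
  0 < n -> (0 < d <= 1)%R ->
  (\sum_(C : {set 'I_n + 'I_n}) \sum_(E : {set 'I_n * 'I_n} | excess_comp E C)
     edge_weight (fun=> (1 - d) / n%:R) E <= 4 / (d ^+ 3 * n%:R))%R.
Proof.
move=> n0 /andP[d0 d1]; have n1 : (1 <= n%:R :> R)%R by rewrite ler1n.
have nR : (0 < n%:R :> R)%R by rewrite ltr0n.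
apply: le_trans (expected_excess_comp _ _) _.
  apply/andP; split; first by rewrite divr_ge0 ?subr_ge0 // ltW.
  by rewrite ler_pdivrMr // mul1r (le_trans _ n1) // gerBl ltW.
have -> : (\sum_(m < (n + n).+1) (2 * n ^ m * m ^ 2)%:R * ((1 - d) / n%:R) ^+ m.+1 =
   2 / n%:R * \sum_(m < (n + n).+1) (m ^ 2)%:R * (1 - d) ^+ m.+1 :> R)%R.
  rewrite mulr_sumr; apply: eq_bigr => m _; rewrite !natrM natrX expr_div_n [(n%:R ^+ m.+1)%R]exprS.
  by field; rewrite gt_eqF // expf_neq0 // gt_eqF.
have := sum_sqr_geometric (r := (1 - d)%R) (n + n).+1.
rewrite subr_ge0 d1 gtrBl d0 => /(_ isT) le2.
have -> : (4 / (d ^+ 3 * n%:R) = 2 / n%:R * (2 / (1 - (1 - d)) ^+ 3))%R.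
  by rewrite opprB addrC subrK; field; rewrite !gt_eqF.
by rewrite ler_wpM2l // divr_ge0 // ltW.
Qed.

(** * Union bound and supercritical comparison *)

(** Each [E] violating [A] is counted at least once on the right. [Q] is trivial for [eps < 0] and
    bounds the order for [eps > 0]. *)
Lemma one_sub_bip_prob_le (R : realType) n (p : R) (A : rel ('I_n + 'I_n) -> Prop)
    (Q : pred {set 'I_n + 'I_n}) : (0 <= p <= 1)%R ->
  (forall E : {set 'I_n * 'I_n}, ~ A (bip_adj E) ->
     exists2 C, Q C & complex_component (bip_adj E) C) ->
  (`|1 - bip_prob p A| <= \sum_(C | Q C)
     \sum_(E : {set 'I_n * 'I_n} | excess_comp E C) edge_weight (fun=> p) E)%R.
Proof.
move=> p01 AQ; have w0 E := edge_weight_ge0 E (fun _ : 'I_n * 'I_n => p01).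
have -> : (1 - bip_prob p A =
   \sum_(E : {set 'I_n * 'I_n} | ~~ `[< A (bip_adj E) >]) edge_weight (fun=> p) E)%R.
  rewrite -(sum_edge_weight (fun _ : 'I_n * 'I_n => p)).
  by rewrite (bigID (fun E => `[< A (bip_adj E) >])) /= addrAC subrr add0r.
rewrite ger0_norm; last by apply: sumr_ge0 => E _.
rewrite (exchange_big_dep predT) //= big_mkcond; apply: ler_sum => E _.
case: ifP => [/asboolP/AQ[C QC /complex_excess exC]|_]; last by apply: sumr_ge0.
by rewrite (bigD1 C) ?QC //= lerDl sumr_ge0.
Qed.

(** To second order the logarithm of [(1 + eps) / (1 - eps / 2)] is [3/2 eps - 3/8 eps^2], so the
    exponent has quadratic slack. The fourth power of [1 + y <= expR y] is precise enough: it leaves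
    [eps^2 / 32] to absorb higher powers. *)
Lemma expR_supercritical (R : realType) (eps : R) : (0 < eps <= 20^-1)%R ->
  (1 + eps <= (1 - eps / 2) * expR (3 / 2 * eps - eps ^+ 2 / 16))%R.
Proof.
case/andP=> e0 e1; pose y := ((3 / 2 * eps - eps ^+ 2 / 16) / 4)%R.
have -> : (3 / 2 * eps - eps ^+ 2 / 16 = y * 4%:R)%R by rewrite /y; field.
have y0 : (0 <= y)%R by rewrite /y; nra.
have e2 : (0 <= 1 - eps / 2)%R by lra.
rewrite expRM_natr.
have y4 : (1 + 4 * y + 6 * y ^+ 2 <= expR y ^+ 4)%R.
  have : ((1 + y) ^+ 4 <= expR y ^+ 4)%R.
    by rewrite lerXn2r ?nnegrE ?expR_ge0 ?expR_ge1Dx // addr_ge0.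
  have y3 : (0 <= y ^+ 3)%R by rewrite exprn_ge0.
  have y4 : (0 <= y ^+ 4)%R by rewrite exprn_ge0.
  apply: le_trans.
  have -> : ((1 + y) ^+ 4 = 1 + 4 * y + 6 * y ^+ 2 + 4 * y ^+ 3 + y ^+ 4)%R by ring.
  lra.
apply: le_trans (ler_wpM2l e2 y4); rewrite /y.
have : (0 <= eps ^+ 2 * (20^-1 - eps))%R by rewrite mulr_ge0 ?exprn_ge0 //; lra.
have : (0 <= eps ^+ 3 * (20^-1 - eps))%R by rewrite mulr_ge0 ?exprn_ge0 //; lra.
have : (0 <= eps ^+ 4 * (20^-1 - eps))%R by rewrite mulr_ge0 ?exprn_ge0 //; lra.
have : (0 <= eps ^+ 2)%R by rewrite exprn_ge0 // ltW.
have : (0 <= eps ^+ 3)%R by rewrite exprn_ge0 // ltW.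
have : (0 <= eps ^+ 4)%R by rewrite exprn_ge0 // ltW.
have : (0 <= eps ^+ 5)%R by rewrite exprn_ge0 // ltW.
rewrite !exprS expr0 !mulr1.
lra.
Qed.

(** The cut gains a factor [expR (- (x * k))], which is at most [q ^+ k]. The one remaining factor
    [q >= 1/4] of [q ^+ k.+1] costs the constant [4]. *)
Lemma excess_comp_supercritical (R : realType) n (eps : R) (C : {set 'I_n + 'I_n}) :
  0 < n -> (0 < eps <= 20^-1)%R -> (12 * #|C|%:R <= eps * n%:R)%R ->
  ((1 + eps) / n%:R <= 1)%R ->
  (\sum_(E : {set 'I_n * 'I_n} | excess_comp E C)
     edge_weight (fun=> (1 + eps) / n%:R) E <=
   4 * \sum_(E : {set 'I_n * 'I_n} | excess_comp E C)
     edge_weight (fun=> (1 - eps / 2) / n%:R) E)%R.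
Proof.
move=> n0 eps01 k12 p1; have [e0 e1] := andP eps01.
have nR : (0 < n%:R :> R)%R by rewrite ltr0n.
pose q := ((1 - eps / 2) / (1 + eps))%R.
pose p := ((1 + eps) / n%:R)%R; pose p' := ((1 - eps / 2) / n%:R)%R.
have pq : (p * q = p')%R by rewrite /p /q /p'; field; rewrite !gt_eqF //; lra.
have p0 : (0 <= p)%R by rewrite divr_ge0 ?ltW //; lra.
have p'0 : (0 < p')%R by rewrite divr_gt0 //; lra.
have p'1 : (p' < 1)%R.
  by apply: lt_le_trans p1; rewrite ltr_pM2r ?invr_gt0 //; lra.
have q01 : (4^-1 <= q <= 1)%R.
  by rewrite ler_pdivlMr ?ler_pdivrMr; [apply/andP; split| |]; lra.
have [q4 q1] := andP q01.
have q0 : (0 < q)%R by lra.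
set k := #|C| in k12 *; set c := #|cut_edges C|.
have cut : (2 * n%:R * k%:R <= 2 * c%:R + k%:R ^+ 2 :> R)%R.
  by rewrite -natrX -!natrM -natrD ler_nat; apply: card_cut_edges.
pose x := (3 / 2 * eps - eps ^+ 2 / 16)%R.
(* Since [c >= n k - k^2 / 2], it suffices that [3/4 eps k^2 / n <= eps^2 k / 16], which follows
   from [12 k <= eps n]. *)
have xk : (x * k%:R <= 3 / 2 * eps / n%:R * c%:R)%R.
  rewrite [leRHS]mulrAC ler_pdivlMr //.
  have : (0 <= eps * (2 * c%:R + k%:R ^+ 2 - 2 * n%:R * k%:R))%R.
    by rewrite mulr_ge0 ?subr_ge0 // ltW.
  have : (0 <= eps * k%:R * (eps * n%:R - 12 * k%:R))%R.
    by rewrite !mulr_ge0 ?subr_ge0 ?ler0n // ltW.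
  rewrite /x; nra.
have qk : (expR (- (x * k%:R)) <= q ^+ k)%R.
  rewrite -mulNr expRM_natr lerXn2r ?nnegrE ?expR_ge0 ?(ltW q0) //.
  rewrite expRN -[leLHS]div1r ler_pdivrMr ?expR_gt0 // /q mulrAC.
  by rewrite ler_pdivlMr ?mul1r ?expR_supercritical //; lra.
have step : (1 - p <= (1 - p') * expR (- (3 / 2 * eps / n%:R)))%R.
  have -> : (3 / 2 * eps / n%:R = p - p')%R by rewrite /p /p'; field; rewrite gt_eqF.
  have : ((1 - p') * (1 - (p - p')) <= (1 - p') * expR (- (p - p')))%R.
    by rewrite ler_wpM2l ?expR_ge1Dx // subr_ge0 ltW.
  apply: le_trans; have : (0 <= p' * (p - p'))%R; last by lra.
  rewrite mulr_ge0 ?(ltW p'0) // subr_ge0 -pq ler_piMr //.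
have factor : ((1 - p) ^+ c <= 4 * (q ^+ k.+1 * (1 - p') ^+ c))%R.
  have : ((1 - p) ^+ c <= (1 - p') ^+ c * q ^+ k)%R.
    apply: le_trans (_ : (((1 - p') * expR (- (3 / 2 * eps / n%:R))) ^+ c <= _)%R).
      by rewrite lerXn2r ?nnegrE ?subr_ge0 // mulr_ge0 ?expR_ge0 // subr_ge0 ltW.
    rewrite exprMn ler_wpM2l ?exprn_ge0 ?subr_ge0 ?(ltW p'1) //.
    apply: le_trans qk; rewrite -expRM_natr ler_expR mulNr lerN2 //.
  move=> /le_trans; apply; rewrite exprS.
  have : (0 <= (1 - p') ^+ c * q ^+ k)%R.
    by rewrite mulr_ge0 ?exprn_ge0 ?subr_ge0 // ltW.
  move: (_ ^+ c)%R (_ ^+ k)%R => s t st; nra.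
have := @excess_comp_thinning R n p q C; rewrite pq p0 p1 (ltW q0) q1.
move=> /(_ isT isT); rewrite -/k -/c -/p -/p'.
set S := (\sum_(E | _) _)%R; set S' := (\sum_(E | _) _)%R => thin.
have S'0 : (0 <= S')%R.
  by apply: sumr_ge0 => E _; apply: edge_weight_ge0 => _; rewrite !ltW.
have D0 : (0 < q ^+ k.+1 * (1 - p') ^+ c)%R.
  by rewrite mulr_gt0 ?exprn_gt0 ?subr_gt0.
rewrite -(ler_pM2l D0); apply: le_trans thin _.
apply: le_trans (ler_wpM2r S'0 factor) _; rewrite le_eqVlt; apply/orP; left; apply/eqP; ring.
Qed.

(** * Asymptotic form of the two bounds *)

Local Open Scope classical_set_scope.
Local Open Scope ring_scope.

Theorem theorem1p9 (R : realType) (eps p : nat -> R)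
    (heps_large : (`|eps n| ^+ 3 * n%:R) @[n --> \oo] --> +oo)
    (heps_small : eps n @[n --> \oo] --> (0 : R))
    (hp : forall n : nat, p n = (1 + eps n) / n%:R) :
  ((\forall n \near \oo, eps n < 0) ->
    (fun n : nat => 1 - bip_prob (p n) (fun e : rel ('I_n + 'I_n) =>
        ~ exists C : {set 'I_n + 'I_n}, complex_component e C))
    =O_\oo (fun n : nat => (`|eps n| ^+ 3 * n%:R)^-1))
  /\
  ((\forall n \near \oo, 0 < eps n) ->
    (fun n : nat => 1 - bip_prob (p n) (fun e : rel ('I_n + 'I_n) =>
        ~ exists C : {set 'I_n + 'I_n},
            complex_component e C /\ #|C|%:R <= n%:R `^ (2 / 3) :> R))
    =O_\oo (fun n : nat => (eps n ^+ 3 * n%:R)^-1)).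
Proof.
split=> [neg|pos]; apply/eqO_exP.
- exists 4%R => //; near=> n.
  have e0 : eps n < 0 by near: n.
  have n0 : (0 < n)%N by near: n; exact: nbhs_infty_gt.
  have e1 : `|eps n| <= 1 by near: n; apply: (cvgr0_norm_le _ heps_small).
  have ne : 0 < `|eps n| by rewrite normr_gt0 lt_eqF.
  have nR : 0 < n%:R :> R by rewrite ltr0n.
  have n1 : 1 <= n%:R :> R by rewrite ler1n.
  have pE : p n = (1 - `|eps n|) / n%:R by rewrite hp ltr0_norm // opprK.
  have p01 : 0 <= p n <= 1.
    rewrite pE divr_ge0 ?subr_ge0 ?(ltW nR) //= ler_pdivrMr // mul1r.
    by rewrite (le_trans _ n1) // gerBl ltW.
  apply: le_trans (one_sub_bip_prob_le (Q := xpredT) p01 _) _.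
    by move=> E /contrapT[C cC]; exists C.
  rewrite pE normfV (gtr0_norm (mulr_gt0 (exprn_gt0 3 ne) nR)).
  by apply: expected_excess_comp_subcritical; rewrite ?ne.
(* The comparison costs [4], and the subcritical bound at [d = eps n / 2] has the constant
   [4 * 2 ^ 3]. *)
- exists 128%R => //; near=> n.
  have e0 : 0 < eps n by near: n.
  have e1 : `|eps n| <= 20^-1 by near: n; apply: (cvgr0_norm_le _ heps_small).
  (* As [1728 = 12 ^ 3], comparing cubes turns the bound [n^(2/3)] on the order into
     [12 * #|C| <= eps n * n]. *)
  have e3 : 1728 <= `|eps n| ^+ 3 * n%:R by near: n; move/cvgryPge : heps_large; apply.
  rewrite gtr0_norm // in e1 e3.
  have nR : 1728 <= n%:R :> R.
    apply: le_trans e3 _; rewrite ler_piMl ?ler0n // exprn_ile1 ?(ltW e0) //; lra.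
  have n0 : (0 < n)%N by rewrite -(ltr_nat R); lra.
  have p01 : 0 <= p n <= 1.
    rewrite hp divr_ge0 ?ler0n //=; last lra.
    by rewrite ler_pdivrMr ?ltr0n // mul1r; lra.
  pose Q (C : {set 'I_n + 'I_n}) := #|C|%:R <= n%:R `^ (2 / 3) :> R.
  apply: le_trans (one_sub_bip_prob_le (Q := Q) p01 _) _.
    by move=> E /contrapT[C [cC QC]]; exists C.
  rewrite normfV gtr0_norm ?mulr_gt0 ?exprn_gt0 ?ltr0n // hp.
  apply: le_trans (_ : 4 * (\sum_(C : {set 'I_n + 'I_n})
      \sum_(E : {set 'I_n * 'I_n} | excess_comp E C)
      edge_weight (fun=> (1 - eps n / 2) / n%:R) E) <= _).
    rewrite mulr_sumr big_mkcond; apply: ler_sum => C _; case: ifPn => [QC|_]; last first.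
      rewrite mulr_ge0 // sumr_ge0 // => E _; apply: edge_weight_ge0 => _.
      by rewrite divr_ge0 ?ler0n ?ler_pdivrMr ?ltr0n //=; lra.
    apply: excess_comp_supercritical; rewrite ?e0 // -?hp; last by case/andP: p01.
    rewrite -(@ler_pXn2r _ 3) ?nnegrE ?mulr_ge0 ?ler0n ?(ltW e0) //.
    have : #|C|%:R ^+ 3 <= n%:R ^+ 2 :> R.
      apply: le_trans (_ : (n%:R `^ (2 / 3)) ^+ 3 <= _).
        by rewrite lerXn2r ?nnegrE ?ler0n ?powR_ge0.
      by rewrite -powR_mulrn ?powR_ge0 // -powRrM divfK // powR_mulrn ?ler0n.
    have : 0 <= (eps n ^+ 3 * n%:R - 1728) * n%:R ^+ 2 by rewrite mulr_ge0 ?subr_ge0 ?exprn_ge0.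
    rewrite !exprMn; lra.
  have half : 0 < eps n / 2 <= 1 by lra.
  apply: le_trans (ler_wpM2l _ (expected_excess_comp_subcritical n0 half)) _ => //.
  rewrite le_eqVlt; apply/orP; left; apply/eqP; field.
  by rewrite !gt_eqF // ltr0n.
Unshelve. all: by end_near.
Qed.
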